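(* Let $M\ge1$ and $d\ge M$ be integers, let $u$ be a smooth function near $\mathbf 0\in\mathbb{R}^n$, and let $q\in\mathbb{P}^d_n$ (a polynomial depending on the cell size $\boldsymbol{\Delta}\mathbf{x}$) be such that $$(\mathbf v(q))_{\boldsymbol\alpha}=\boldsymbol{\Delta}\mathbf{x}^{\boldsymbol\alpha-\mathbf 1}\int_{\Omega_0}\partial_{\boldsymbol\alpha}q(\mathbf{x})\,d\mathbf{x}=\sum_{\substack{|\boldsymbol\beta|=0\\ \boldsymbol\beta\text{ even}}}^{M-|\boldsymbol\alpha|}\frac{\partial_{\boldsymbol\alpha+\boldsymbol\beta}u(\mathbf 0)}{2^{|\boldsymbol\beta|}(\boldsymbol\beta+\mathbf 1)!}\boldsymbol{\Delta}\mathbf{x}^{\boldsymbol\alpha+\boldsymbol\beta}+\mathcal{O}(\rho^{M+1})\qquad\text{for }1\le|\boldsymbol\alpha|\le M,$$ as $\rho\to0$. Then $$I[q]=B_M+R[q],$$ where $B_M$ and $R[q]$ are the quantities defined in the context, and $B_M$ depends on $M$ (and on $u$ and $\boldsymbol{\Delta}\mathbf{x}$) but not on $q$; in particular it does not depend on the degree $d$.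
   Context: Multi-index notation: for $\boldsymbol\alpha\in\mathbb{N}^n$, $|\boldsymbol\alpha|=\sum_i\alpha_i$, $\boldsymbol\alpha!=\prod_i\alpha_i!$, $\mathbf{x}^{\boldsymbol\alpha}=\prod_i x_i^{\alpha_i}$, $\partial_{\boldsymbol\alpha}$ is the partial derivative of multi-order $\boldsymbol\alpha$, $\mathbf 1=(1,\dots,1)$; $\boldsymbol\alpha$ is even if every $\alpha_i$ is even. $\mathbb{P}^d_n$ is the space of real polynomials in $n$ variables of degree at most $d$. $\Omega_0=\prod_{i=1}^n[-\Delta x_i/2,\Delta x_i/2]$ is the cell centred at $\mathbf 0$ with side lengths $\boldsymbol{\Delta}\mathbf{x}=(\Delta x_1,\dots,\Delta x_n)$ and diameter $\rho=\|\boldsymbol{\Delta}\mathbf{x}\|_2$. The smoothness indicator of $q\in\mathbb{P}^d_n$ is $I[q]=\sum_{1\le|\boldsymbol\beta|\le d}\boldsymbol{\Delta}\mathbf{x}^{2\boldsymbol\beta-\mathbf 1}\int_{\Omega_0}(\partial_{\boldsymbol\beta}q(\mathbf{x}))^2\,d\mathbf{x}$. The vector $\mathbf v(q)$, indexed by the multi-indices with $|\boldsymbol\alpha|\le d$, has components $(\mathbf v(q))_{\boldsymbol\alpha}=\boldsymbol{\Delta}\mathbf{x}^{\boldsymbol\alpha-\mathbf 1}\int_{\Omega_0}\partial_{\boldsymbol\alpha}q\,d\mathbf{x}$. Let $\mathbf C$ be the (unique) constant symmetric matrix, indexed by multi-indices with $|\boldsymbol\alpha|\le d$ and depending only on $n$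 and $d$, such that $I[p]=\langle\mathbf v(p),\mathbf C\,\mathbf v(p)\rangle$ for all $p\in\mathbb{P}^d_n$ and all cell sizes. Define $\mathbf v^{B_M}$, indexed by $|\boldsymbol\alpha|\le d$, by $$(\mathbf v^{B_M})_{\boldsymbol\alpha}=\sum_{\substack{|\boldsymbol\beta|=0\\ \boldsymbol\beta\text{ even}}}^{M-|\boldsymbol\alpha|}\frac{\partial_{\boldsymbol\alpha+\boldsymbol\beta}u(\mathbf 0)}{2^{|\boldsymbol\beta|}(\boldsymbol\beta+\mathbf 1)!}\boldsymbol{\Delta}\mathbf{x}^{\boldsymbol\alpha+\boldsymbol\beta}\ \text{ if }1\le|\boldsymbol\alpha|\le M,\qquad (\mathbf v^{B_M})_{\boldsymbol\alpha}=0\ \text{ if }|\boldsymbol\alpha|=0\text{ or }|\boldsymbol\alpha|>M,$$ and $\mathbf v^{R[q]}=\mathbf v(q)-\mathbf v^{B_M}$. Then $$B_M:=\langle\mathbf v^{B_M},\mathbf C\,\mathbf v^{B_M}\rangle,\qquad R[q]:=2\langle\mathbf v^{B_M},\mathbf C\,\mathbf v^{R[q]}\rangle+\langle\mathbf v^{R[q]},\mathbf C\,\mathbf v^{R[q]}\rangle.$$ *)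

(* Defs.v *)
From HB Require Import structures.
From mathcomp Require Import all_boot all_order all_algebra.
(* mpoly is imported without its notations, whose levels clash with those of
   mathcomp-analysis: multinom n is 'X_{1..n}, bmultinom n k is 'X_{1..n < k},
   mpoly n R is {mpoly R[n]}, mderivm m p is p^`M[m], meval v p is p.@[v]. *)
From mathcomp Require Import -(notations) mpoly.
From mathcomp Require Import all_classical all_reals all_analysis.

Import Order.TTheory GRing.Theory Num.Theory.
Import numFieldNormedType.Exports.

Set Implicit Arguments.
Unset Strict Implicit.
Unset Printing Implicit Defensive.
Local Open Scope classical_set_scope.
Local Open Scope ring_scope.

Section cons_measure.
Context d (T : measurableType d) (R : realType) (n : nat).
Variable m : {sigma_finite_measure set T -> \bar R}.
Variable mu : {sigma_finite_measure set (n.-tuple T) -> \bar R}.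

Definition pcons (p : T * n.-tuple T) : n.+1.-tuple T := [tuple of p.1 :: p.2].

Lemma measurable_pcons : measurable_fun [set: T * n.-tuple T] pcons.
Proof. exact: (@measurable_cons _ _ _ _ fst _ snd). Qed.

Definition cons_measure := pushforward (m \x mu)%E pcons.

HB.instance Definition _ := Measure.copy cons_measure
  (measure_function_pushforward__canonical__measure_function_Measure
    (m \x mu)%E measurable_pcons).

Let cons_measure_sigma_finite : sigma_finite setT cons_measure.
Proof.
have /sigma_finiteP[F [FT ndF Foo]] := sigma_finiteT m.
have /sigma_finiteP[G [GT ndG Goo]] := sigma_finiteT mu.
pose g (t : n.+1.-tuple T) : T * n.-tuple T := (thead t, [tuple of behead t]).
have gK : cancel pcons g.
  by case=> x t; rewrite /g theadE; congr (_, _); exact/val_inj.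
have mg : measurable_fun [set: n.+1.-tuple T] g.
  apply: measurable_fun_pair; first exact: measurable_tnth.
  exact: measurable_behead.
exists (fun k => g @^-1` (F k `*` G k)).
  apply/esym; rewrite -subTset => t _.
  have [i _ Fi] : (\bigcup_i F i) (g t).1 by rewrite -FT.
  have [j _ Gj] : (\bigcup_j G j) (g t).2 by rewrite -GT.
  exists (maxn i j) => //; split.
    by move: Fi; exact/subsetPset/ndF/leq_maxl.
  by move: Gj; exact/subsetPset/ndG/leq_maxr.
move=> k; have [mF Fk] := Foo k; have [mG Gk] := Goo k; split.
  by rewrite -[X in measurable X]setTI; apply: mg => //; exact: measurableX.
rewrite /cons_measure /pushforward -comp_preimage.
rewrite (_ : g \o pcons = id); last by apply/funext => x /=; rewrite gK.
by rewrite preimage_id product_measure1E// lte_mul_pinfty// ge0_fin_numE.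
Qed.

HB.instance Definition _ := Measure_isSigmaFinite.Build _ _ _ cons_measure
  cons_measure_sigma_finite.

End cons_measure.

(* n-dimensional Lebesgue measure, as the n-fold product of the one-dimensional
   one transported along (x_1, (x_2, .., x_n)) |-> (x_1, .., x_n). *)
Fixpoint lebesgue_tuple (R : realType) (n : nat) :
    {sigma_finite_measure set (n.-tuple (measurableTypeR R)) -> \bar R} :=
  if n is n'.+1 then cons_measure (@lebesgue_measure R) (lebesgue_tuple R n')
  else \d_([tuple] : 0.-tuple (measurableTypeR R)).

Section smooth.
Variables (R : realType) (n : nat).
Implicit Types u : 'rV[R]_n -> R.

Definition partial (i : 'I_n) u : 'rV[R]_n -> R :=
  fun x => 'D_(delta_mx 0 i) u x.

Definition mpartial (a : multinom n) u : 'rV[R]_n -> R :=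
  foldr (fun i f => iter (a i) (partial i) f) u (enum 'I_n).

(* C^oo on a neighbourhood of 0: there, the partial derivatives of all orders
   (s lists the successive directions) exist and are continuous. *)
Definition smooth_near0 u : Prop :=
  \forall x \near (0 : 'rV[R]_n), forall s : seq 'I_n,
    {for x, continuous (foldr partial u s)} /\
    forall i, derivable (foldr partial u s) x (delta_mx 0 i).

End smooth.

Section indicator.
Variables (R : realType) (n : nat).
Implicit Types (h : 'rV[R]_n) (a b : multinom n) (q : mpoly n R)
  (v w : multinom n -> R).

(* h is the vector of the side lengths. *)
Definition is_cell h : Prop := forall i, 0 < h 0 i.

Definition diameter h : R := Num.sqrt (\sum_(i < n) h 0 i ^+ 2).

(* The filter "rho -> 0" on cell sizes; the diameter of h tends to 0 iff h tends
   to 0 in R^n, with no restriction on the aspect ratios. *)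
Definition cell_to0 : set_system 'rV[R]_n := within is_cell (nbhs (0 : 'rV[R]_n)).

Global Instance cell_to0_filter : Filter cell_to0.
Proof. exact: within_filter. Qed.

Canonical cell_to0_filter_on := FilterType cell_to0 cell_to0_filter.

Definition cell h : set (n.-tuple (measurableTypeR R)) :=
  [set x | forall i, - (h 0 i / 2) <= tnth x i <= h 0 i / 2].

Definition cell_int h (f : n.-tuple (measurableTypeR R) -> R) : R :=
  \int[lebesgue_tuple R n]_(x in cell h) f x.

(* The exponents 2 beta - 1 and alpha - 1 are in Z, since alpha - 1 may have
   entries equal to -1. *)
Definition hpow h (e : 'I_n -> int) : R := \prod_(i < n) h 0 i ^ e i.

Definition smoothness_indicator (d : nat) h q : R :=
  \sum_(b : bmultinom n d.+1 | (1 <= mdeg b)%N)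
    hpow h (fun i => 2 * (b i)%:Z - 1) *
    cell_int h (fun x => meval (tnth x) (mderivm b q) ^+ 2).

(* Vectors indexed by |alpha| <= d are represented by functions of all
   multi-indices, only read at the |alpha| <= d. *)
Definition vec h q : multinom n -> R := fun a =>
  hpow h (fun i => (a i)%:Z - 1) *
  cell_int h (fun x => meval (tnth x) (mderivm a q)).

Definition cform (d : nat) (C : bmultinom n d.+1 -> bmultinom n d.+1 -> R)
    v w : R :=
  \sum_(a : bmultinom n d.+1) v a * \sum_(b : bmultinom n d.+1) C a b * w b.

Definition is_indicator_matrix (d : nat)
    (C : bmultinom n d.+1 -> bmultinom n d.+1 -> R) : Prop :=
  (forall a b : bmultinom n d.+1, C a b = C b a) /\
  forall h q, is_cell h -> (mpoly.msize q <= d.+1)%N ->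
    smoothness_indicator d h q = cform C (vec h q) (vec h q).

(* The unique matrix with that property. It exists and is unique because
   I[q] and v(q) only depend on the polynomial y |-> q(h y) on the unit cube, and
   q |-> v(q) is a bijection from polynomials of degree at most d onto vectors
   indexed by |alpha| <= d. *)
Definition indicator_matrix (d : nat) :
    bmultinom n d.+1 -> bmultinom n d.+1 -> R :=
  get [set C | is_indicator_matrix C].

Definition meven a : bool := [forall i, ~~ odd (a i)].

Definition taylor_avg (M : nat) (u : 'rV[R]_n -> R) h a : R :=
  \sum_(b : bmultinom n (M - mdeg a).+1 | meven b)
    mpartial (mnm_add a b) u 0 / (2 ^+ mdeg b * (\prod_(i < n) (b i).+1`!)%N%:R) *
    \prod_(i < n) h 0 i ^+ mnm_add a b i.

Definition vecB (M : nat) (u : 'rV[R]_n -> R) h : multinom n -> R := fun a =>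
  if (1 <= mdeg a <= M)%N then taylor_avg M u h a else 0.

Definition indicator_B (M d : nat) (u : 'rV[R]_n -> R) h : R :=
  cform (@indicator_matrix d) (vecB M u h) (vecB M u h).

Definition indicator_R (M d : nat) (u : 'rV[R]_n -> R) h q : R :=
  let vB := vecB M u h in
  let vR := fun a => vec h q a - vB a in
  2 * cform (@indicator_matrix d) vB vR + cform (@indicator_matrix d) vR vR.

End indicator.

Arguments cell_to0 R n : clear implicits.

(* Main.v *)
Require Import Defs.
From HB Require Import structures.
From mathcomp Require Import all_boot all_order all_algebra.
From mathcomp Require Import -(notations) mpoly.
From mathcomp Require Import all_classical all_reals all_analysis.
From mathcomp Require Import measurable_realfun ring lra.

Set Implicit Arguments.
Unset Strict Implicit.
Unset Printing Implicit Defensive.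

Import Order.TTheory GRing.Theory Num.Theory.
Import numFieldNormedType.Exports.

Local Open Scope classical_set_scope.
Local Open Scope ring_scope.

(** Both claims follow from the existence of one symmetric matrix C that
    represents the smoothness indicator for all cells and all polynomials of
    degree at most d.

    Existence.  Put P(y) = q(h y), the dilation of q to the unit cube centred at
    the origin.  The chain rule and the scaling of the integral ([vecE],
    [smoothness_indicatorE]) absorb all the powers of h: the entry of v(q) at a
    is the integral of d_a P over the unit cube, and I[q] is the sum over
    |b| >= 1 of the integrals of (d_b P)^2.  So the cell has disappeared from
    both sides.  The linear map sending P to the integrals of its derivatives is
    triangular with respect to the degree, its diagonal entries being the
    factorials a!, hence it is bijective from polynomials of degree at most d
    onto families indexed by |a| <= d ([unit_moments_surj],
    [unit_moments_inj]).  Expanding P in the dual basis of these functionals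
    writes the quadratic form I[q] in terms of v(q), which gives C
    ([indicator_matrix_exists]).

    Decomposition.  Once C represents I, the identity I[q] = B_M + R[q] is the
    expansion of the form at v(q) = v^B + v^R, where the symmetry of C merges the
    two cross terms ([cform_sum_sub]).

    Independence of d.  The family v^B vanishes beyond order M, so by
    surjectivity it is v(q) for some polynomial q of degree at most M.  For such
    a q the derivatives of order above M vanish, so the indicators of degrees d
    and M agree on q ([cform_indicator_matrix_widen]).

    The integrals reduce to one-dimensional ones: the Lebesgue measure on tuples
    is an iterated product, so the integral of a product of functions of the
    separate coordinates is the product of the integrals
    ([lebesgue_tuple_prod]); this is applied to monomials restricted to the
    cell. *)

(** * Integrals of functions with separated variables *)

Section ProductIntegral.
Context d1 d2 (T1 : measurableType d1) (T2 : measurableType d2) (R : realType).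
Variables (m1 : {sigma_finite_measure set T1 -> \bar R}).
Variables (m2 : {sigma_finite_measure set T2 -> \bar R}).
Variables (f : T1 -> R) (g : T2 -> R).
Hypothesis intf : m1.-integrable setT (EFin \o f).
Hypothesis intg : m2.-integrable setT (EFin \o g).

Let mfg : measurable_fun setT (fun z : T1 * T2 => (f z.1 * g z.2)%:E).
Proof.
apply/measurable_EFinP/measurable_funM.
  apply: (@measurableT_comp _ _ _ _ _ _ f) => //.
  by apply/measurable_EFinP/(measurable_int m1).
apply: (@measurableT_comp _ _ _ _ _ _ g) => //.
by apply/measurable_EFinP/(measurable_int m2).
Qed.

Lemma integrable_tensor :
  (m1 \x m2)%E.-integrable setT (fun z => (f z.1 * g z.2)%:E).
Proof.
have /integrableP[mf fy] := intf; have /integrableP[mg gy] := intg.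
apply/integrable12ltyP => //.
have E x : (\int[m2]_y `|(f x * g y)%:E| =
    `|(f x)%:E| * \int[m2]_y `|(g y)%:E|)%E.
  under eq_integral => y _ do rewrite EFinM abseM.
  by rewrite ge0_integralZl//; exact: measurableT_comp.
under eq_integral do rewrite E.
rewrite ge0_integralZr//; [|exact: measurableT_comp|exact: integral_ge0].
by apply: lte_mul_pinfty => //; rewrite ?ge0_fin_numE//; exact: integral_ge0.
Qed.

Lemma integral_tensor :
  (\int[m1 \x m2]_z (f z.1 * g z.2)%:E =
   (\int[m1]_x (f x)%:E) * (\int[m2]_y (g y)%:E))%E.
Proof.
rewrite -integral12_prod_meas1; last exact: integrable_tensor.
have E x : (\int[m2]_y (f x * g y)%:E = (f x)%:E * \int[m2]_y (g y)%:E)%E.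
  by under eq_integral => y _ do rewrite EFinM; rewrite integralZl.
rewrite /fubini_F /=; under eq_integral do rewrite E.
have /fineK<- := integrable_fin_num measurableT intg.
by rewrite integralZr.
Qed.

End ProductIntegral.

Section TupleIntegral.
Context (R : realType).

(** Integrability and value are proved together, because each step of the
    induction on the dimension applies Fubini's theorem, which asks for the
    integrability of the product of the remaining factors. *)
Lemma lebesgue_tuple_prod n (f : 'I_n -> measurableTypeR R -> R) :
  (forall i, (@lebesgue_measure R).-integrable setT (EFin \o f i)) ->
  (lebesgue_tuple R n).-integrable setT
      (fun x => (\prod_i f i (tnth x i))%:E) /\
  (\int[lebesgue_tuple R n]_x (\prod_i f i (tnth x i))%:E =
   (\prod_i \int[@lebesgue_measure R]_t f i t)%:E)%E.
Proof.
elim: n f => [|n IH] f intf /=.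
  have -> : (fun x : 0.-tuple (measurableTypeR R) =>
      (\prod_i f i (tnth x i))%:E) = cst 1%E.
    by apply/funext => x; rewrite big_ord0.
  split.
    apply/integrableP; split; first exact: measurable_cst.
    by rewrite integral_dirac//= diracT mul1e normr1 ltry.
  by rewrite integral_dirac//= diracT mul1e big_ord0.
have [intg Eg] := IH (fun i => f (lift ord0 i)) (fun i => intf _).
have E : ((fun x : n.+1.-tuple (measurableTypeR R) =>
    (\prod_i f i (tnth x i))%:E) \o @pcons _ (measurableTypeR R) n) =
  (fun z => (f ord0 z.1 * \prod_i f (lift ord0 i) (tnth z.2 i))%:E).
  apply/funext => z /=; congr EFin; rewrite big_ord_recl; congr (_ * _).
  by apply: eq_bigr => i _; rewrite tnthS.
have intE := integrable_tensor (intf ord0) intg.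
have mf : measurable_fun setT (fun x : n.+1.-tuple (measurableTypeR R) =>
    (\prod_i f i (tnth x i))%:E).
  apply/measurable_EFinP.
  apply: (@measurable_prod _ _ _ _ _ _
    (fun i (x : n.+1.-tuple _) => f i (tnth x i))) => i _.
  have /integrableP[/measurable_EFinP mfi _] := intf i.
  by apply: (measurableT_comp mfi); exact: measurable_tnth.
split.
  apply: integrable_pushforward => //; first exact: measurable_pcons.
  by rewrite preimage_setT E.
rewrite integral_pushforward//; last first.
- by rewrite preimage_setT E.
- exact: measurable_pcons.
rewrite preimage_setT E.
have -> := integral_tensor (intf ord0) intg.
rewrite Eg big_ord_recl EFinM.
by rewrite /Rintegral fineK//; exact: (integrable_fin_num measurableT (intf ord0)).
Qed.

End TupleIntegral.

(** * Monomials over a cell *)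

Section CellIntegral.
Context (R : realType).

(** The integral of t ^+ k from -1/2 to 1/2. *)
Definition moment (k : nat) : R :=
  ((1 / 2) ^+ k.+1 - (- (1 / 2)) ^+ k.+1) / k.+1%:R.

Lemma moment0 : moment 0 = 1.
Proof. by rewrite /moment; lra. Qed.

Lemma integrable_exprn_segment (a b : R) k :
  (@lebesgue_measure R).-integrable `[a, b] (EFin \o (fun t => t ^+ k)).
Proof.
apply: continuous_compact_integrable; first exact: segment_compact.
by apply: continuous_subspaceT; exact: exprn_continuous.
Qed.

Lemma Rintegral_exprn_segment (s : R) k : 0 < s ->
  \int[@lebesgue_measure R]_(t in `[- (s / 2), s / 2]) t ^+ k =
  s ^+ k.+1 * moment k.
Proof.
move=> s_gt0; rewrite /Rintegral.
pose F (t : R) := k.+1%:R^-1 * t ^+ k.+1.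
have cF : continuous F.
  by move=> x; apply: cvgM; [exact: cvg_cst|exact: exprn_continuous].
have dF (x : R) : is_derive x 1 F (x ^+ k).
  have := is_deriveZ (k.+1%:R^-1 : R) (is_deriveX k.+1 (is_derive_id x (1 : R))).
  rewrite (_ : _ \*: _ = F); last by apply/funext => t; rewrite /F/= exprfctE.
  by rewrite /= [(_)%:A]mulr1 scalerA mulVf ?pnatr_eq0// scale1r.
rewrite (@continuous_FTC2 _ _ F) /=.
- rewrite /moment /F -mulrBr mulrC mulrA; congr (_ / _).
  have -> : - (s / 2) = s * - (1 / 2) by lra.
  have -> : s / 2 = s * (1 / 2) by lra.
  by rewrite !exprMn mulrBr.
- lra.
- exact/continuous_subspaceT/exprn_continuous.
- split; first by move=> x _; apply: ex_derive.
  + exact/cvg_at_right_filter/cF.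
  + exact/cvg_at_left_filter/cF.
- by move=> x _; rewrite derive1E; apply: derive_val.
Qed.

Variable n : nat.
Implicit Types (h : 'rV[R]_n) (p : mpoly n R).

Lemma measurable_cell h : measurable (cell h).
Proof.
have -> : cell h = \bigcap_(i in [set: 'I_n])
    (fun x => tnth x i) @^-1` `[- (h 0 i / 2), h 0 i / 2].
  apply/seteqP; split => x /=.
    by move=> hx i _ /=; rewrite in_itv/=.
  by move=> hx i; have := hx i I; rewrite /= in_itv.
apply: fin_bigcap_measurable => [|i _]; first exact: finite_finset.
by rewrite -[X in measurable X]setTI; exact: measurable_tnth.
Qed.

(** Restricting each factor to its side of the cell turns an integral over the
    cell into an integral over the whole space that still separates the
    variables. *)
Lemma prod_restrict_cell h (f : 'I_n -> R -> R) :
  (fun x => \prod_i f i (tnth x i)) \_ (cell h) =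
  (fun x => \prod_i (f i \_ `[- (h 0 i / 2), h 0 i / 2]) (tnth x i)).
Proof.
apply/funext => x; rewrite patchE; case: ifPn => [|]; rewrite ?inE ?notin_setE.
  move=> xh; apply: eq_bigr => i _; rewrite patchE mem_set//=.
  by rewrite in_itv/=; exact: xh.
by move=> /existsNP[i xi]; rewrite (bigD1 i)//= patchE memNset ?mul0r.
Qed.

Lemma cell_int_exprn h (k : 'I_n -> nat) : is_cell h ->
  (lebesgue_tuple R n).-integrable (cell h)
     (EFin \o (fun x => \prod_i tnth x i ^+ k i)) /\
  cell_int h (fun x => \prod_i tnth x i ^+ k i) =
    \prod_i (h 0 i ^+ (k i).+1 * moment (k i)).
Proof.
move=> h0.
pose f i : measurableTypeR R -> R :=
  (fun t : R => t ^+ k i) \_ `[- (h 0 i / 2), h 0 i / 2].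
have intf i : (@lebesgue_measure R).-integrable setT (EFin \o f i).
  rewrite -restrict_EFin.
  have := integrable_exprn_segment (- (h 0 i / 2)) (h 0 i / 2) (k i).
  by apply: (integrable_mkcond _ _).1; exact: measurable_itv.
have [fint fE] := lebesgue_tuple_prod intf.
have E := prod_restrict_cell h (fun i t => t ^+ k i).
split.
  apply/integrable_mkcond; first exact: measurable_cell.
  by rewrite restrict_EFin E.
rewrite /cell_int Rintegral_mkcond E /Rintegral fE/=.
apply: eq_bigr => i _.
by rewrite -Rintegral_mkcond; exact: Rintegral_exprn_segment.
Qed.

End CellIntegral.

(** * Derivatives and dilations of polynomials *)

Section MpolyFacts.
Context (R : realType) (n : nat).
Implicit Types (h : 'rV[R]_n) (p : mpoly n R) (a m : multinom n).

Lemma msize_leP p k :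
  (forall m, (k <= mdeg m)%N -> mcoeff m p = 0) -> (mpoly.msize p <= k)%N.
Proof.
move=> pk; rewrite msizeE; apply/bigmax_leqP_seq => m mp _.
rewrite ltnNge; apply/negP => /pk/eqP.
by rewrite mcoeff_eq0 mp.
Qed.

Lemma mcoeff_msize p m : (mpoly.msize p <= mdeg m)%N -> mcoeff m p = 0.
Proof. by move=> /msize_mdeg_ge; rewrite -mcoeff_eq0 => /eqP. Qed.

Lemma mderivm_eq0 p a : (mpoly.msize p <= mdeg a)%N -> mderivm a p = 0.
Proof.
move=> pa; apply/mpolyP => m; rewrite mcoeff_mderivm mcoeff0 mcoeff_msize ?mul0rn//.
by rewrite mdegD (leq_trans pa)// leq_addr.
Qed.

Definition mfact a : nat := \prod_i (a i)`!.

Lemma mfact_neq0 a : (mfact a)%:R != 0 :> R.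
Proof. by rewrite pnatr_eq0 -lt0n prodn_gt0// => i; exact: fact_gt0. Qed.

(** Every monomial other than x^a has a smaller exponent than a in some variable,
    because its degree is at most |a|, so the derivative kills it. The factor a!
    is the diagonal entry of the triangular system solved in
    [unit_moments_surj]. *)
Lemma mderivm_top p a : (mpoly.msize p <= (mdeg a).+1)%N ->
  mderivm a p = mpolyC n (mcoeff a p * (mfact a)%:R).
Proof.
move=> pa; apply/mpolyP => m; rewrite mcoeff_mderivm mcoeffC.
have [->|m0] := eqVneq m mnm0.
  rewrite addm0 mulr1 mulr_natr; congr (_ *+ _).
  by apply: eq_bigr => i _; rewrite ffactnn.
rewrite mulr0 mcoeff_msize ?mul0rn// mdegD (leq_trans pa)//.
by rewrite -addn1 leq_add2l lt0n mdeg_eq0.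
Qed.

Definition hmon h a : R := \prod_i h 0 i ^+ a i.

Lemma hmonD h a m : hmon h (mnm_add a m) = hmon h a * hmon h m.
Proof.
by rewrite /hmon -big_split; apply: eq_bigr => i _; rewrite mnmDE exprD.
Qed.

Definition dilate h : mpoly n R -> mpoly n R :=
  comp_mpoly [tuple h 0 i *: mpolyX R (mnm1 i) | i < n].

HB.instance Definition _ h := GRing.LRMorphism.copy (dilate h) (comp_mpoly _).

Lemma dilateX h a : dilate h (mpolyX R a) = hmon h a *: mpolyX R a.
Proof.
rewrite /dilate comp_mpolyX [X in _ *: X]mpolyXE_id /hmon -scaler_prod.
by apply: eq_bigr => i _; rewrite tnth_mktuple exprZn.
Qed.

(** Dilation rescales each coefficient separately, so that identities about it
    can be checked coefficientwise. *)
Lemma dilateE h p :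
  dilate h p = \sum_(m <- msupp p) (hmon h m * mcoeff m p) *: mpolyX R m.
Proof.
rewrite [LHS]comp_mpolyEX; apply: eq_bigr => m _.
by rewrite -/(dilate h _) dilateX scalerA mulrC.
Qed.

Lemma mcoeff_dilate h p a : mcoeff a (dilate h p) = hmon h a * mcoeff a p.
Proof.
rewrite dilateE [X in _ = _ * mcoeff _ X]mpolyE !raddf_sum/= mulr_sumr.
apply: eq_bigr => m _; rewrite !mcoeffZ mcoeffX.
by have [->|] := eqVneq m a; rewrite ?mulr0// !mulr1.
Qed.

(** The chain rule for the change of variables x = h y. *)
Lemma mderivm_dilate h p a :
  mderivm a (dilate h p) = hmon h a *: dilate h (mderivm a p).
Proof.
apply/mpolyP => m; rewrite mcoeffZ mcoeff_dilate !mcoeff_mderivm mcoeff_dilate.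
by rewrite hmonD -!mulrnAr mulrA.
Qed.

Lemma msize_dilate h p k :
  (mpoly.msize p <= k)%N -> (mpoly.msize (dilate h p) <= k)%N.
Proof.
move=> pk; apply: msize_leP => m km.
by rewrite mcoeff_dilate mcoeff_msize ?mulr0//; exact: leq_trans km.
Qed.

Lemma dilateK h p : is_cell h -> dilate h (dilate (\row_i (h 0 i)^-1) p) = p.
Proof.
move=> h0; apply/mpolyP => m; rewrite !mcoeff_dilate mulrA -big_split/= big1 ?mul1r//.
by move=> i _; rewrite mxE -exprMn divff ?expr1n// gt_eqF.
Qed.

End MpolyFacts.

(** * Reduction to the unit cube *)

Section MomentFunctional.
Context (R : realType) (n : nat).
Implicit Types (h : 'rV[R]_n) (p : mpoly n R) (a b m : multinom n).

Definition mpoly_int h p : R := cell_int h (fun x => meval (tnth x) p).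

Lemma mpoly_intX h a : is_cell h ->
  mpoly_int h (mpolyX R a) = \prod_i (h 0 i ^+ (a i).+1 * moment R (a i)).
Proof.
move=> h0; have [_ <-] := cell_int_exprn a h0.
by apply: eq_Rintegral => x _; rewrite mevalX.
Qed.

Lemma integrable_mpoly h p : is_cell h ->
  (lebesgue_tuple R n).-integrable (cell h) (EFin \o (fun x => meval (tnth x) p)).
Proof.
move=> h0.
have -> : EFin \o (fun x => meval (tnth x) p) =
  (fun x : n.-tuple (measurableTypeR R) =>
    \sum_(m <- msupp p) (mcoeff m p)%:E * (\prod_i tnth x i ^+ m i)%:E)%E.
  by apply/funext => x /=; rewrite mevalE -sumEFin.
apply: integrable_sum => [|m _]; first exact: measurable_cell.
apply: integrableZl; first exact: measurable_cell.
by have [] := cell_int_exprn m h0.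
Qed.

Lemma mpoly_int_linear h : is_cell h -> linear_for *%R (mpoly_int h).
Proof.
move=> h0 c p q; rewrite /mpoly_int /cell_int.
have mh := measurable_cell h.
have ip r := integrable_mpoly r h0.
rewrite -(RintegralZl c mh (ip p)) -(RintegralD mh _ (ip q)).
  by apply: eq_Rintegral => x _; rewrite mevalD mevalZ.
have := ip (c *: p).
by congr (_.-integrable _ _); apply/funext => x /=; rewrite mevalZ.
Qed.

Lemma mpoly_int_sum h I (r : seq I) (c : I -> R) (F : I -> mpoly n R) :
  is_cell h ->
  mpoly_int h (\sum_(i <- r) c i *: F i) = \sum_(i <- r) c i * mpoly_int h (F i).
Proof.
move=> h0; elim: r => [|i r IH]; last by rewrite !big_cons mpoly_int_linear// IH.
rewrite !big_nil; have := mpoly_int_linear h0 (-1) 0 0.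
by rewrite scaler0 addr0 mulN1r addNr.
Qed.

(** The integral over the unit cube centred at the origin. *)
Definition unit_int : mpoly n R -> R := mpoly_int (const_mx 1).

Let is_cell1 : is_cell (const_mx 1 : 'rV[R]_n).
Proof. by move=> i; rewrite mxE ltr01. Qed.

HB.instance Definition _ := GRing.isLinear.Build R (mpoly n R) R *%R unit_int
  (mpoly_int_linear is_cell1).

Lemma unit_intZ c p : unit_int (c *: p) = c * unit_int p.
Proof. exact: linearZZ. Qed.

Lemma unit_intC (c : R) : unit_int (mpolyC n c) = c.
Proof.
rewrite -[mpolyC n c]mulr1 mul_mpolyC unit_intZ -(mpolyX0 n) /unit_int.
by rewrite mpoly_intX// big1 ?mulr1// => i _; rewrite mxE mnm0E moment0 !mul1r.
Qed.

(** The change of variables x = h y, checked on monomials. *)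
Lemma mpoly_int_dilate h p : is_cell h ->
  mpoly_int h p = (\prod_i h 0 i) * unit_int (dilate h p).
Proof.
move=> h0.
rewrite {1}[p]mpolyE dilateE /unit_int !mpoly_int_sum// mulr_sumr.
apply: eq_bigr => m _; rewrite [_ * mcoeff m p]mulrC -mulrA mulrCA; congr (_ * _).
rewrite !mpoly_intX// mulrA -!big_split; apply: eq_bigr => i _ /=.
by rewrite mxE expr1n mul1r exprS.
Qed.

(** The volume of the cell turns the weight h^(a - 1) into h^a, which is exactly
    the factor that the chain rule produces; so v(q) depends on the cell only
    through the dilation of q. *)
Lemma vecE h q a : is_cell h -> vec h q a = unit_int (mderivm a (dilate h q)).
Proof.
move=> h0; rewrite mderivm_dilate unit_intZ /vec -/(mpoly_int h _).
rewrite mpoly_int_dilate// mulrA; congr (_ * _).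
rewrite /hpow /hmon -big_split; apply: eq_bigr => i _ /=.
by rewrite [RHS]exprnP -[X in _ * X]expr1z -expfzDr ?gt_eqF// subrK.
Qed.

Definition unit_indicator (d : nat) p : R :=
  \sum_(b : bmultinom n d.+1 | (1 <= mdeg b)%N) unit_int (mderivm b p ^+ 2).

(** As in [vecE], the volume of the cell turns the weight h^(2b - 1) into h^(2b),
    the square of the chain rule factor. *)
Lemma smoothness_indicatorE d h q : is_cell h ->
  smoothness_indicator d h q = unit_indicator d (dilate h q).
Proof.
move=> h0; apply: eq_bigr => b _.
rewrite mderivm_dilate exprZn unit_intZ -rmorphXn/=.
have -> : cell_int h (fun x => meval (tnth x) (mderivm b q) ^+ 2) =
    mpoly_int h (mderivm b q ^+ 2).
  by apply: eq_Rintegral => x _; rewrite rmorphXn.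
rewrite mpoly_int_dilate// mulrA; congr (_ * _).
rewrite /hpow /hmon -prodrXl -big_split; apply: eq_bigr => i _ /=.
rewrite -[X in _ * X]expr1z -expfzDr ?gt_eqF// subrK.
by rewrite -exprM exprnP mulnC PoszM.
Qed.

(** Solved from the top degree downwards: the homogeneous part T of degree k is
    dictated by the moments of order k, and a polynomial of lower degree then
    corrects the moments of lower order without changing those of order k. *)
Lemma unit_moments_surj k (w : multinom n -> R) : exists p,
  (mpoly.msize p <= k)%N /\
  forall a, (mdeg a < k)%N -> unit_int (mderivm a p) = w a.
Proof.
elim: k w => [|k IH] w; first by exists 0; rewrite msize0.
pose T := \sum_(b : bmultinom n k.+1 | mdeg b == k)
   (w b / (mfact b)%:R) *: mpolyX R b : mpoly n R.
have T_coef a : mcoeff a T = if mdeg a == k then w a / (mfact a)%:R else 0.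
  rewrite raddf_sum/=; case: ifPn => ak.
    have ak1 : (mdeg a < k.+1)%N by rewrite (eqP ak).
    rewrite (bigD1 (BMultinom ak1))//= mcoeffZ mcoeffX eqxx mulr1.
    rewrite big1 ?addr0// => b /andP[_].
    by rewrite mcoeffZ mcoeffX -val_eqE/= => /negbTE ->; rewrite mulr0.
  rewrite big1// => b bk; rewrite mcoeffZ mcoeffX.
  by have [ba|] := eqVneq (b : multinom n) a; rewrite ?mulr0//; rewrite -ba bk in ak.
have T_size : (mpoly.msize T <= k.+1)%N.
  by apply: msize_leP => m km; rewrite T_coef gtn_eqF.
have [p [pk pE]] := IH (fun a => w a - unit_int (mderivm a T)).
exists (p + T); split.
  apply: msize_leP => m km.
  rewrite mcoeffD !mcoeff_msize ?addr0//; first exact: leq_trans T_size km.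
  exact: leq_trans pk (ltnW km).
move=> a; rewrite ltnS leq_eqVlt => /predU1P[ak|ak]; rewrite mderivmD raddfD/=.
  rewrite mderivm_eq0 ?ak// raddf0 add0r mderivm_top ?ak// unit_intC T_coef ak eqxx.
  by rewrite divfK// mfact_neq0.
by rewrite pE// subrK.
Qed.

(** The moments of top order are nonzero multiples of the top coefficients, so
    their vanishing lowers the degree. *)
Lemma unit_moments_inj k p : (mpoly.msize p <= k)%N ->
  (forall a, (mdeg a < k)%N -> unit_int (mderivm a p) = 0) -> p = 0.
Proof.
elim: k => [|k IH] pk p0.
  by apply/eqP; rewrite -msize_poly_eq0 -leqn0.
apply: IH => [|a ak]; last by apply: p0; exact: ltnW.
apply: msize_leP => m; rewrite leq_eqVlt => /predU1P[km|km]; last first.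
  by apply: mcoeff_msize; exact: leq_trans pk km.
have := p0 m; rewrite -km ltnSn mderivm_top -?km// unit_intC => /(_ isT)/eqP.
by rewrite mulf_eq0 (negbTE (mfact_neq0 _ _)) orbF => /eqP.
Qed.

End MomentFunctional.

(** * The matrix of the smoothness indicator *)

Section IndicatorMatrix.
Context (R : realType) (n : nat).
Implicit Types (h : 'rV[R]_n) (p q : mpoly n R) (v w : multinom n -> R).

Section DualBasis.
Variable d : nat.
Local Notation idx := (bmultinom n d.+1).

(** The basis of the polynomials of degree at most d that is dual to the moment
    functionals; it does not depend on any cell, whence a constant matrix. *)
Lemma moment_dual_basis : exists e : idx -> mpoly n R,
  forall p, (mpoly.msize p <= d.+1)%N ->
    p = \sum_(a : idx) unit_int (mderivm a p) *: e a.
Proof.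
have [e eP] := choice (fun a : idx =>
  unit_moments_surj d.+1 (fun b => (b == a :> multinom n)%:R : R)).
exists e => p pd; apply/eqP; rewrite -subr_eq0; apply/eqP.
apply: (@unit_moments_inj _ _ d.+1).
  apply: msize_leP => m dm; rewrite mcoeffB raddf_sum/= mcoeff_msize ?(leq_trans pd)//.
  rewrite big1 ?subr0// => a _; rewrite mcoeffZ mcoeff_msize ?mulr0//.
  exact: leq_trans (eP a).1 dm.
move=> b bd; rewrite mderivmB raddfB/= !raddf_sum/=.
rewrite (bigD1 (BMultinom bd))//= big1 ?addr0 => [|a ab].
  by rewrite mderivmZ unit_intZ (eP _).2// eqxx mulr1 subrr.
have /negbTE ba : b != a by apply: contraNneq ab => ba; apply/eqP/val_inj.
by rewrite mderivmZ unit_intZ (eP _).2// ba mulr0 oppr0.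
Qed.

Lemma indicator_matrix_exists :
  exists C : idx -> idx -> R, is_indicator_matrix C.
Proof.
have [e eP] := moment_dual_basis.
(* The Gram matrix of the dual basis for the bilinear form of the indicator. *)
exists (fun a b => \sum_(g : idx | (1 <= mdeg g)%N)
  unit_int (mderivm g (e a) * mderivm g (e b))); split.
  by move=> a b; apply: eq_bigr => g _; rewrite mulrC.
move=> h q h0 qd; rewrite smoothness_indicatorE// /unit_indicator /cform.
set P := dilate h q.
have PE g : mderivm g P = \sum_(a : idx) vec h q a *: mderivm g (e a).
  rewrite {1}(eP P) ?msize_dilate// raddf_sum; apply: eq_bigr => a _ /=.
  by rewrite mderivmZ vecE.
transitivity (\sum_(g : idx | (1 <= mdeg g)%N) \sum_(a : idx) vec h q a *
    \sum_(b : idx) unit_int (mderivm g (e a) * mderivm g (e b)) * vec h q b).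
  apply: eq_bigr => g _; rewrite expr2 {1}PE mulr_suml raddf_sum/=.
  apply: eq_bigr => a _; rewrite -scalerAl unit_intZ PE mulr_sumr raddf_sum/=.
  congr (_ * _); apply: eq_bigr => b _.
  by rewrite -scalerAr unit_intZ mulrC.
rewrite exchange_big/=; apply: eq_bigr => a _; rewrite -mulr_sumr exchange_big/=.
by congr (_ * _); apply: eq_bigr => b _; rewrite mulr_suml.
Qed.

Lemma indicator_matrixP : is_indicator_matrix (@indicator_matrix R n d).
Proof.
exact: (@getPex _ [set C | is_indicator_matrix C] indicator_matrix_exists).
Qed.

End DualBasis.

Lemma cform_sum_sub d (C : bmultinom n d.+1 -> bmultinom n d.+1 -> R) v w :
  (forall a b, C a b = C b a) ->
  cform C v v = cform C w w +
    (2 * cform C w (fun a => v a - w a) +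
     cform C (fun a => v a - w a) (fun a => v a - w a)).
Proof.
move=> Csym.
have Cbil x1 x2 y1 y2 : cform C (fun a => x1 a + x2 a) (fun a => y1 a + y2 a) =
    cform C x1 y1 + cform C x1 y2 + (cform C x2 y1 + cform C x2 y2).
  rewrite -!big_split; apply: eq_bigr => a _ /=.
  have -> : \sum_b C a b * (y1 b + y2 b) =
      \sum_b C a b * y1 b + \sum_b C a b * y2 b.
    by rewrite -big_split; apply: eq_bigr => b _ /=; rewrite mulrDr.
  by ring.
have Ccom x y : cform C x y = cform C y x.
  rewrite /cform; under eq_bigr do rewrite mulr_sumr.
  rewrite exchange_big; apply: eq_bigr => b _ /=; rewrite mulr_sumr.
  by apply: eq_bigr => a _; rewrite Csym; ring.
pose r a := v a - w a.
have -> : v = (fun a => w a + r a) by apply/funext => a; rewrite addrC subrK.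
rewrite Cbil (Ccom r w) (_ : (fun a => w a + r a - w a) = r); first by ring.
by apply/funext => a; rewrite addrAC subrr add0r.
Qed.

Lemma eq_cform d (C : bmultinom n d.+1 -> bmultinom n d.+1 -> R) v w :
  (forall a : bmultinom n d.+1, v a = w a) -> cform C v v = cform C w w.
Proof.
move=> vw; apply: eq_bigr => a _; rewrite vw; congr (_ * _).
by apply: eq_bigr => b _; rewrite vw.
Qed.

Lemma unit_indicator_widen M d p : (mpoly.msize p <= M.+1)%N -> (M <= d)%N ->
  unit_indicator d p = unit_indicator M p.
Proof.
move=> pM Md; rewrite /unit_indicator.
rewrite (bigID (fun b : bmultinom n d.+1 => (mdeg b < M.+1)%N))/= addrC.
rewrite big1 ?add0r; last first.
  move=> b /andP[_]; rewrite -leqNgt => bM.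
  by rewrite mderivm_eq0 ?expr0n ?raddf0// (leq_trans pM).
pose incl (b : bmultinom n M.+1) : bmultinom n d.+1 :=
  BMultinom (leq_trans (bmdeg b) (Md : (M.+1 <= d.+1)%N)).
rewrite (reindex_omap incl (fun b => insub (bmnm b)))/=; last first.
  by move=> b /andP[_ bM]; rewrite insubT/=; congr Some; exact/val_inj.
apply: eq_bigl => b; rewrite bmdeg andbT.
by rewrite valK eqxx andbT.
Qed.

(** Solve for the moments on the unit cube, then undo the dilation. *)
Lemma vec_surj h k w : is_cell h -> exists q, (mpoly.msize q <= k)%N /\
  forall a, (mdeg a < k)%N -> vec h q a = w a.
Proof.
move=> h0; have [p [pk pE]] := unit_moments_surj k w.
exists (dilate (\row_i (h 0 i)^-1) p); split; first exact: msize_dilate.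
by move=> a ak; rewrite vecE// dilateK// pE.
Qed.

(** The family w is v(q) for some q of degree at most M, so both forms evaluate
    to the indicator of q; derivatives of order above M contribute nothing to
    it. *)
Lemma cform_indicator_matrix_widen h M d w : is_cell h -> (M <= d)%N ->
  (forall a, (M < mdeg a)%N -> w a = 0) ->
  cform (@indicator_matrix R n d) w w = cform (@indicator_matrix R n M) w w.
Proof.
move=> h0 Md w0; have [q [qM qE]] := vec_surj M.+1 w h0.
have wE a : vec h q a = w a.
  have [aM|aM] := ltnP (mdeg a) M.+1; first exact: qE.
  by rewrite w0// vecE// mderivm_eq0 ?raddf0// msize_dilate// (leq_trans qM).
have IE k : (M <= k)%N -> cform (@indicator_matrix R n k) w w =
    unit_indicator M (dilate h q).
  move=> Mk; rewrite -(@eq_cform _ _ (vec h q))//.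
  rewrite -(indicator_matrixP k).2//; last by rewrite (leq_trans qM).
  by rewrite smoothness_indicatorE// (unit_indicator_widen (M := M))// msize_dilate.
by rewrite !IE.
Qed.

End IndicatorMatrix.

Theorem proposition3 (R : realType) (n M d : nat)
    (M_ge1 : (1 <= M)%N) (M_le_d : (M <= d)%N)
    (u : 'rV[R]_n -> R) (u_smooth : smooth_near0 u)
    (q : 'rV[R]_n -> mpoly n R)
    (q_deg : forall h, is_cell h -> (mpoly.msize (q h) <= d.+1)%N)
    (q_approx : forall a : multinom n, (1 <= mdeg a <= M)%N ->
      (fun h => vec h (q h) a) =
        (fun h => taylor_avg M u h a)
          +O_ (cell_to0 R n) (fun h => diameter h ^+ M.+1)) :
  (forall h, is_cell h ->
    smoothness_indicator d h (q h)
      = indicator_B M d u h + indicator_R M d u h (q h)) /\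
  (forall h d', is_cell h -> (M <= d')%N ->
    indicator_B M d' u h = indicator_B M d u h).
Proof.
have [Csym CI] := @indicator_matrixP R n d.
split=> [h h0|h d' h0 Md'].
  by rewrite CI ?q_deg// (cform_sum_sub _ (vecB M u h)).
have vB0 a : (M < mdeg a)%N -> vecB M u h a = 0.
  by move=> Ma; rewrite /vecB [(mdeg a <= M)%N]leqNgt Ma andbF.
by rewrite /indicator_B !(cform_indicator_matrix_widen (M := M) h0).
Qed.
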